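(* Let $G=(V\cup\{m\},E)$ and $G'=(V'\cup\{m'\},E')$ be comparability graphs with disjoint vertex sets such that $m$ is a source of some transitive orientation of $G$ and $m'$ is a sink of some transitive orientation of $G'$. If $\mathcal{R}^p(G)=k$ and $\mathcal{R}^p(G')=k'$, then $\mathcal{R}^p(G\ast G')=\max\{k,k'\}$ or $\mathcal{R}^p(G\ast G')=1+\max\{k,k'\}$.
   Context: All graphs are finite, simple and connected. A comparability graph is a graph admitting a transitive orientation ($\overrightarrow{ab},\overrightarrow{bc}$ imply $\overrightarrow{ac}$); a source (sink) is a vertex of in-degree (out-degree) zero. A word over the vertex set represents a graph if distinct vertices are adjacent iff they alternate in the word (the subword formed by their occurrences is $abab\cdots$ or $baba\cdots$). Comparability graphs are exactly the graphs represented by a concatenation of permutations of their vertex set; $\mathcal{R}^p(G)$ is the least number of permutations whose concatenation represents $G$. Split recomposition: $G\ast G'$ has vertex set $V\cup V'$ and edges: those of $G[V]$, those of $G'[V']$, and all $\overline{ab}$ with $a\in N_G(m)$, $b\in N_{G'}(m')$.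
   Formalization: The sets V and V' are assumed nonempty; otherwise the claim fails, e.g. for G a single vertex m and G' a path on three vertices with m' an end vertex, where k=1, k'=2 but G*G' is a single edge with value 1. *)

(* Defs.v *)
From mathcomp Require Import all_boot.

Set Implicit Arguments.
Unset Strict Implicit.
Unset Printing Implicit Defensive.

Record sgraph := SGraph {
  vertex :> finType;
  edge : rel vertex;
  edge_sym : symmetric edge;
  edge_irrefl : irreflexive edge
}.

Definition connected (G : sgraph) : Prop :=
  forall x y : G, connect (@edge G) x y.

(* An orientation r chooses exactly one direction, r x y meaning x -> y, for
   each edge of G, and relates no other pair. *)
Definition orientation (G : sgraph) (r : rel G) : Prop :=
  (forall x y : G, edge x y = r x y || r y x)
  /\ (forall x y : G, ~~ (r x y && r y x)).

Definition transitive_orientation (G : sgraph) (r : rel G) : Prop :=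
  orientation r /\ transitive r.

Definition comparability_graph (G : sgraph) : Prop :=
  exists r : rel G, transitive_orientation r.

Definition in_degree (G : sgraph) (r : rel G) (x : G) : nat :=
  #|[set y | r y x]|.

Definition out_degree (G : sgraph) (r : rel G) (x : G) : nat :=
  #|[set y | r x y]|.

Definition source (G : sgraph) (r : rel G) (x : G) : Prop := in_degree r x = 0.

Definition sink (G : sgraph) (r : rel G) (x : G) : Prop := out_degree r x = 0.

Definition subword2 (T : eqType) (w : seq T) (x y : T) : seq T :=
  [seq z <- w | (z == x) || (z == y)].

(* The word xyxy... of length n. *)
Definition alternating_word (T : Type) (x y : T) (n : nat) : seq T :=
  mkseq (fun i => if odd i then y else x) n.

Definition alternate (T : eqType) (w : seq T) (x y : T) : Prop :=
  exists n, subword2 w x y = alternating_word x y n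
         \/ subword2 w x y = alternating_word y x n.

(* As usual for word-representants, every vertex must occur in the word; in
   particular the empty word does not represent a complete graph. *)
Definition represents (G : sgraph) (w : seq G) : Prop :=
  (forall x : G, x \in w)
  /\ (forall x y : G, x != y -> (edge x y <-> alternate w x y)).

Definition permutation_of_vertices (G : sgraph) (p : seq G) : bool :=
  perm_eq p (enum G).

Definition perm_representable (G : sgraph) (k : nat) : Prop :=
  exists ps : seq (seq G),
    [/\ size ps = k, all (@permutation_of_vertices G) ps
      & represents (flatten ps)].

(* is_Rp G k reads R^p(G) = k; no such k exists when G is not a comparability
   graph. *)
Definition is_Rp (G : sgraph) (k : nat) : Prop :=
  perm_representable G k /\ (forall j, perm_representable G j -> k <= j).

Section SplitRecomposition.

Variables (G G' : sgraph) (m : G) (m' : G').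

(* The disjoint union of V and V', the vertices of G and G' other than the
   marked vertices m and m'. *)
Definition recomp_vertex : finType :=
  ({x : G | x != m} + {x : G' | x != m'})%type.

Definition recomp_edge (u v : recomp_vertex) : bool :=
  match u, v with
  | inl a, inl b => edge (val a) (val b)
  | inr a, inr b => edge (val a) (val b)
  | inl a, inr b => edge m (val a) && edge m' (val b)
  | inr b, inl a => edge m (val a) && edge m' (val b)
  end.

Lemma recomp_edge_sym : symmetric recomp_edge.
Proof. by move=> [a|a] [b|b] //=; rewrite edge_sym. Qed.

Lemma recomp_edge_irrefl : irreflexive recomp_edge.
Proof. by move=> [a|a] /=; rewrite edge_irrefl. Qed.

Definition split_recomposition : sgraph :=
  SGraph recomp_edge_sym recomp_edge_irrefl.

End SplitRecomposition.

(* Main.v *)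
(** Two letters alternate in a concatenation of permutations iff all the
    permutations order them alike, so R^p(G) is the least number of linear orders
    whose intersection is a transitive orientation of G.

    Lower bound: a neighbour of m' (resp. m) plays the part of m (resp. m') in
    G * G', so both G and G' are induced subgraphs of G * G'.

    Upper bound: take K = max(k, k') linear orders for G and for G'. If m is a
    source and m' a sink of the orientations they induce, write the i-th orders
    as Z m W and X m' Y; the K orders Z X W Y together with one order placing all
    of V' before all of V represent G * G'.

    The given orders need not make m a source. To repair them, compare the
    orientation P they induce with one, Q, having m as a source, and colour a pair
    by "no edge", "P and Q agree" or "P and Q disagree". Transitivity forbids
    rainbow triangles, so by Gallai's theorem one colour is disconnected. The
    component H of m in this colour is a proper module; by induction it has
    orders with m as a source, which are then substituted for m in orders on the
    rest: the original ones if the colour is "disagree", the reversed ones if it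
    is "agree", and the original ones with m moved first if it is "no edge". *)

Require Import Defs.
From mathcomp Require Import all_boot zify.
From Stdlib Require Import Classical.

Set Implicit Arguments.
Unset Strict Implicit.
Unset Printing Implicit Defensive.

(** * Lexicographic combination of two position functions *)

Section Lex.
Variables (T : finType) (p q : T -> nat).

(** The factor [(\max_y q y).+1] exceeds every value of [q], so [q] only breaks ties of [p]. *)
Definition lex (x : T) : nat := p x * (\max_y q y).+1 + q x.

Lemma lex_lt x y : (lex x < lex y) = (p x < p y) || (p x == p y) && (q x < q y).
Proof.
have /(_ x) qx := @leq_bigmax T q; have /(_ y) qy := @leq_bigmax T q.
rewrite /lex; move: (\max_y q y) qx qy => N qx qy.
case: (ltngtP (p x) (p y)) => /= [lt_p|lt_p|->]; last by rewrite ltn_add2l.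
  by nia.
by apply/negbTE; rewrite -leqNgt; nia.
Qed.

Lemma lex_inj x y : lex x = lex y -> p x = p y /\ q x = q y.
Proof.
move=> eq_xy; have := lex_lt x y; have := lex_lt y x; rewrite eq_xy ltnn.
by case: (ltngtP (p x) (p y)) => //= ->; case: (ltngtP (q x) (q y)).
Qed.

End Lex.

(** * Alternation in concatenated permutations *)

Section Words.
Variable T : eqType.
Implicit Types (x y : T) (p w : seq T) (ps : seq (seq T)).

Lemma alternating_wordSS x y n :
  alternating_word x y n.+2 = [:: x, y & alternating_word x y n].
Proof.
rewrite /alternating_word /mkseq /= (iotaDl 2 0 n) -map_comp.
by congr [:: _, _ & _]; apply: eq_map => i /=; rewrite negbK.
Qed.

Lemma subword2_uniq p x y : uniq p -> x != y -> x \in p -> y \in p ->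
  subword2 p x y = if index x p < index y p then [:: x; y] else [:: y; x].
Proof.
rewrite /subword2; elim: p => //= z p IHp /andP[zp Up] neq_xy.
have one t u : t \notin p -> u \in p -> [seq v <- p | (v == t) || (v == u)] = [:: u].
  move=> tp up; rewrite -(filter_pred1_uniq Up up).
  apply: eq_in_filter => v vp /=; case: eqP => //= vt.
  by rewrite -vt vp in tp.
rewrite !inE [x == z]eq_sym [y == z]eq_sym.
have [zx|zx] := eqVneq z x.
  subst z; rewrite (negPf neq_xy) /= => _ yp.
  by rewrite one.
have [zy|zy] := eqVneq z y => /=.
  subst z => xp _.
  rewrite (eq_filter (a2 := fun v => (v == y) || (v == x))) ?one //.
  by move=> v; rewrite orbC.
by move=> xp yp; rewrite IHp.
Qed.

(** Each permutation contributes a block of two letters, so a word alternating from [x] has [x] at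
    the start of every block. *)
Lemma alternating_flatten (x y : T) (b : pred (seq T)) ps n : x != y ->
  flatten [seq if b p then [:: x; y] else [:: y; x] | p <- ps]
    = alternating_word x y n -> all b ps.
Proof.
move=> neq_xy; elim: ps n => //= p ps IHps [|[|n]].
- by case: (b p).
- by case: (b p).
rewrite alternating_wordSS; case: (b p) => /= -[] => [/IHps //|_ eq_xy].
by rewrite eq_xy eqxx in neq_xy.
Qed.

Lemma flatten_alternating (x y : T) (b : pred (seq T)) ps : all b ps ->
  flatten [seq if b p then [:: x; y] else [:: y; x] | p <- ps]
    = alternating_word x y (size ps).*2.
Proof.
elim: ps => //= p ps IHps /andP[-> /IHps ->].
by rewrite doubleS alternating_wordSS.
Qed.

Lemma alternate_flatten x y ps : x != y ->
    {in ps, forall p, [/\ uniq p, x \in p & y \in p]} ->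
  alternate (flatten ps) x y <->
    all (fun p => index x p < index y p) ps \/
    all (fun p => index y p < index x p) ps.
Proof.
move=> neq_xy ps_ok; rewrite /alternate.
have -> : subword2 (flatten ps) x y = flatten
    [seq if index x p < index y p then [:: x; y] else [:: y; x] | p <- ps].
  rewrite /subword2 filter_flatten; congr flatten.
  apply/eq_in_map => p /ps_ok[Up xp yp]; exact: subword2_uniq.
(* Exchanging the roles of the letters reduces words starting with [y] to those starting with
   [x]. *)
have flip : flatten
      [seq if index x p < index y p then [:: x; y] else [:: y; x] | p <- ps]
    = flatten
      [seq if index y p < index x p then [:: y; x] else [:: x; y] | p <- ps].
  congr flatten; apply/eq_in_map => p /ps_ok[_ xp yp].
  by case: ltngtP => // /(index_inj x xp yp) eq_xy; case/eqP: neq_xy.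
split=> [[n []]|[] all_ps].
- by move/(alternating_flatten neq_xy); left.
- rewrite flip => /alternating_flatten; rewrite eq_sym => /(_ neq_xy).
  by right.
- by exists (size ps).*2; left; rewrite flatten_alternating.
- by exists (size ps).*2; right; rewrite flip flatten_alternating.
Qed.

End Words.

(** * Realizers *)

Section Realizers.
Variables (T : finType) (e : rel T).

(* A linear order is encoded by the injective function giving positions; it
   is only meaningful on the set under consideration. *)
Definition before (I : finType) (f : I -> T -> nat) (x y : T) : bool :=
  [forall i, f i x < f i y].

(** For nonempty [I], the intersection of the orders [f i] is a partial order on [A] with
    comparability graph [e]: a realizer in the sense of dimension theory. *)
Definition realizer (I : finType) (A : {set T}) (f : I -> T -> nat) : Prop :=
  (forall i, {in A &, injective (f i)})
  /\ {in A &, forall x y, x != y -> e x y = before f x y || before f y x}.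

Lemma realizer_sub (I : finType) (A B : {set T}) (f : I -> T -> nat) :
  A \subset B -> realizer B f -> realizer A f.
Proof.
move=> /subsetP sAB [f_inj f_e]; split=> [i|] x y /sAB xB /sAB yB.
  exact: f_inj.
exact: f_e.
Qed.

Lemma before_irr (I : finType) (i : I) (f : I -> T -> nat) x : before f x x = false.
Proof. by apply/negbTE/forallPn; exists i; rewrite ltnn. Qed.

Lemma before_asym (I : finType) (i : I) (f : I -> T -> nat) x y :
  before f x y -> before f y x = false.
Proof.
move=> /forallP/(_ i) lt_xy; apply/negbTE/forallPn; exists i.
by rewrite -leqNgt ltnW.
Qed.

Lemma realizer_edge (I : finType) (i : I) (f : I -> T -> nat) :
  irreflexive e -> realizer [set: T] f ->
  forall x y, e x y = before f x y || before f y x.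
Proof.
move=> e_irr [_ f_e] x y; have [<-|neq_xy] := eqVneq x y; last by rewrite f_e ?inE.
by rewrite e_irr (before_irr i).
Qed.

Definition reverse (I : finType) (f : I -> T -> nat) (i : I) (x : T) : nat :=
  \max_y f i y - f i x.

Lemma reverse_lt (I : finType) (f : I -> T -> nat) i x y :
  (reverse f i x < reverse f i y) = (f i y < f i x).
Proof.
have /(_ x) fx := @leq_bigmax T (f i); have /(_ y) fy := @leq_bigmax T (f i).
by rewrite /reverse; lia.
Qed.

Lemma before_reverse (I : finType) (f : I -> T -> nat) x y :
  before (reverse f) x y = before f y x.
Proof. by apply: eq_forallb => i; rewrite reverse_lt. Qed.

Lemma realizer_reverse (I : finType) (A : {set T}) (f : I -> T -> nat) :
  realizer A f -> realizer A (reverse f).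
Proof.
move=> [f_inj f_e]; split=> [i|] x y xA yA.
  move=> eq_xy; have := reverse_lt f i x y; have := reverse_lt f i y x.
  by rewrite eq_xy ltnn; case: (ltngtP (f i x) (f i y)) => // + _ _; apply: f_inj.
by move=> neq_xy; rewrite !before_reverse orbC f_e.
Qed.

Lemma realizer_reindex (I J : finType) (h : J -> I) (A : {set T})
    (f : I -> T -> nat) :
  (forall i, exists j, h j = i) -> realizer A f -> realizer A (fun j => f (h j)).
Proof.
move=> h_surj [f_inj f_e].
have bE x y : before (fun j => f (h j)) x y = before f x y.
  apply/forallP/forallP => lt_xy i; last exact: lt_xy.
  by have [j <-] := h_surj i; apply: lt_xy.
split=> [j|x y xA yA neq_xy]; first exact: f_inj.
by rewrite !bE f_e.
Qed.

Lemma realizer_widen k K (A : {set T}) (f : 'I_k -> T -> nat) :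
  0 < k -> k <= K -> realizer A f -> exists g : 'I_K -> T -> nat, realizer A g.
Proof.
case: k f => // k f _ le_kK f_real.
(* There are now [k.+1] orders; indices above [k] repeat the last one, which leaves the intersection
   unchanged. *)
exists (fun j => f (inord (minn j k))); apply: realizer_reindex f_real => i.
have lt_iK : i < K by apply: leq_trans le_kK.
exists (Ordinal lt_iK); apply: val_inj; rewrite /= inordK //; have := ltn_ord i; lia.
Qed.

End Realizers.

Lemma realizer_pullback (T U I : finType) (e : rel T) (e' : rel U) (h : T -> U)
    (f : I -> U -> nat) :
  injective h -> (forall x y, e x y = e' (h x) (h y)) ->
  realizer e' [set: U] f -> realizer e [set: T] (fun i x => f i (h x)).
Proof.
move=> h_inj h_e [f_inj f_e]; split=> [i x y _ _ /f_inj|x y _ _ neq_xy].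
  by rewrite !inE => /(_ isT isT)/h_inj.
by rewrite h_e f_e ?inE // (inj_eq h_inj).
Qed.

(** * From permutation words to realizers and back *)

Lemma perm_representable_gt0 (G : sgraph) (x : G) k :
  perm_representable G k -> 0 < k.
Proof. by case=> -[|p ps] [<- _ []] // /(_ x). Qed.

Lemma perm_representable_realizer (G : sgraph) k :
  perm_representable G k ->
  exists f : 'I_k -> G -> nat, realizer (@edge G) [set: G] f.
Proof.
case=> ps [<- ps_perm [_ ps_rep]].
have perm_p p : p \in ps -> perm_eq p (enum G) by apply: (allP ps_perm).
exists (fun i x => index x (nth [::] ps i)).
split=> [i x y _ _|x y _ _ neq_xy].
  have p_i : nth [::] ps i \in ps by rewrite mem_nth.
  have mem_i u : u \in nth [::] ps i by rewrite (perm_mem (perm_p _ p_i)) mem_enum.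
  exact: index_inj x _ _ _ (mem_i x) (mem_i y).
have beforeE u v : before (fun i : 'I_(size ps) => index^~ (nth [::] ps i)) u v
    = all (fun p => index u p < index v p) ps.
  apply/forallP/(all_nthP [::]) => [lt_uv i lt_i|lt_uv i].
    exact: (lt_uv (Ordinal lt_i)).
  exact: lt_uv.
rewrite !beforeE; apply/idP/orP.
  move=> /(ps_rep _ _ neq_xy)/alternate_flatten; apply=> // p /perm_p p_perm.
  by rewrite (perm_uniq p_perm) enum_uniq !(perm_mem p_perm) !mem_enum.
move=> lt_xy; apply/(ps_rep _ _ neq_xy)/alternate_flatten => // p /perm_p p_perm.
by rewrite (perm_uniq p_perm) enum_uniq !(perm_mem p_perm) !mem_enum.
Qed.

Lemma realizer_perm_representable (G : sgraph) (I : finType) (i0 : I)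
    (f : I -> G -> nat) :
  realizer (@edge G) [set: G] f -> perm_representable G #|I|.
Proof.
move=> [f_inj f_e].
pose s i := sort (fun x y => f i x <= f i y) (enum G).
have perm_s i : perm_eq (s i) (enum G) by rewrite perm_sort.
have mem_s i x : x \in s i by rewrite (perm_mem (perm_s i)) mem_enum.
have uniq_s i : uniq (s i) by rewrite (perm_uniq (perm_s i)) enum_uniq.
have index_s i x y : (index x (s i) < index y (s i)) = (f i x < f i y).
  have le_s u v : (index u (s i) <= index v (s i)) -> f i u <= f i v.
    have le_tr : transitive (fun x y => f i x <= f i y).
      by move=> a b c; apply: leq_trans.
    have le_refl : reflexive (fun x y => f i x <= f i y) by move=> a.
    apply: (sorted_leq_index le_tr le_refl) => //.
    by apply: sort_sorted => a b; apply: leq_total.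
  case: (ltngtP (index x (s i))) => [lt_xy|lt_xy|/(index_inj x (mem_s i x) (mem_s i y)) ->].
  - have := le_s _ _ (ltnW lt_xy); rewrite leq_eqVlt => /orP[/eqP|->] //.
    by move/f_inj => eq_xy; rewrite eq_xy ?inE ?ltnn in lt_xy.
  - by apply/esym/negbTE; rewrite -leqNgt le_s // ltnW.
  by rewrite ltnn.
have beforeE x y : all (fun p => index x p < index y p) [seq s i | i <- enum I]
    = before f x y.
  rewrite all_map; apply/allP/forallP => [lt_xy i|lt_xy i _] /=.
    by rewrite -index_s; apply: lt_xy; rewrite mem_enum.
  by rewrite index_s.
exists [seq s i | i <- enum I]; split.
- by rewrite size_map -cardE.
- by apply/allP => _ /mapP[i _ ->]; apply: perm_s.
split=> [x|x y neq_xy].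
  apply/flattenP; exists (s i0) => //; apply: map_f; exact: mem_enum.
rewrite alternate_flatten //; last by move=> _ /mapP[i _ ->].
by rewrite !beforeE f_e ?inE //; split=> /orP.
Qed.

(** * Gallai colourings *)

Section GallaiColouring.
Variables (T : finType) (C : eqType) (c : T -> T -> C).
Hypothesis c_sym : forall x y, c x y = c y x.
Hypothesis c_rainbow : forall x y z, x != y -> y != z -> x != z ->
  [|| c x y == c y z, c x y == c x z | c y z == c x z].

Definition coloured (A : {set T}) (i : C) : rel T :=
  [rel x y | [&& x \in A, y \in A, x != y & c x y == i]].

Lemma coloured_sym A i : symmetric (coloured A i).
Proof. by move=> x y; rewrite /coloured /= eq_sym c_sym; case: (x \in A); case: (y \in A). Qed.

Lemma coloured_connect_sym A i : connect_sym (coloured A i).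
Proof. exact/sym_connect_sym/coloured_sym. Qed.

Lemma coloured_connect_mem A i x y :
  connect (coloured A i) x y -> x \in A -> y \in A.
Proof.
move=> con_xy; rewrite (closed_connect _ con_xy) //.
by apply: intro_closed => [|u v /and4P[]//]; apply: coloured_connect_sym.
Qed.

(* The colour components are modules of every other colour. *)
Lemma component_uniform (A : {set T}) i x y z : z \in A -> x \in A ->
  ~~ connect (coloured A i) x z -> connect (coloured A i) x y ->
  c z x != i /\ c z y = c z x.
Proof.
move=> zA xA ncon_xz con_xy.
have out u : u \in A -> connect (coloured A i) x u -> z != u /\ c z u != i.
  move=> uA con_xu; have neq_zu : z != u.
    by apply: contraNneq ncon_xz => ->.
  split=> //; apply: contra ncon_xz => czu; apply: connect_trans con_xu _.
  by apply: connect1; rewrite /coloured /= uA zA eq_sym neq_zu c_sym.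
have [_ czx] := out x xA (connect0 _ _); split=> //.
(* This set is closed under edges of colour [i]: if [c u v = i] while [c z u] and [c z v] differ
   from [i], then these two are equal, the triangle not being rainbow. *)
pose a := [pred u | connect (coloured A i) x u && (c z u == c z x)].
suff : y \in a by case/andP=> _ /eqP.
rewrite -(closed_connect _ con_xy) ?inE ?connect0 ?eqxx //.
apply: intro_closed => [|u v uv]; first exact: coloured_connect_sym.
rewrite !inE => /andP[con_xu /eqP <-].
have con_xv := connect_trans con_xu (connect1 uv); rewrite con_xv /=.
case/and4P: uv => uA vA neq_uv /eqP cuv.
have [zu czu] := out u uA con_xu; have [zv czv] := out v vA con_xv.
have := c_rainbow zu neq_uv zv; rewrite cuv (negPf czu) /=.
by rewrite [i == _]eq_sym (negPf czv) orbF eq_sym.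
Qed.

Definition connected_colour (A : {set T}) (i : C) : Prop :=
  {in A &, forall x y, connect (coloured A i) x y}.

Lemma connected_colour_edge (A : {set T}) i v w : connected_colour A i ->
  v \in A -> w \in A -> v != w -> exists2 x, x \in A :\ v & c v x = i.
Proof.
move=> conA vA wA neq_vw; have /connectP[[|x p]] := conA v w vA wA.
  by move=> _ eq_wv; rewrite eq_wv eqxx in neq_vw.
move=> /andP[/and4P[_ xA neq_vx /eqP cvx] _] _; exists x => //.
by rewrite !inE eq_sym neq_vx.
Qed.

(** Without such a [u], the component of [z] in [A :\ v] would be closed in [A] too, and [v] could
    not be reached from [z]. *)
Lemma component_edge (A : {set T}) i v z : connected_colour A i ->
  v \in A -> z \in A :\ v ->
  exists2 u, connect (coloured (A :\ v) i) z u & c v u = i.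
Proof.
move=> conA vA zAv; case: (pickP [pred u | connect (coloured (A :\ v) i) z u & c v u == i]).
  by move=> u /andP[con_zu /eqP cvu]; exists u.
move=> none; have /setD1P[_ zA] := zAv.
have : connect (coloured (A :\ v) i) z v.
  have con_zv := conA z v zA vA.
  rewrite -[connect _ _ _]/(v \in [pred u | connect (coloured (A :\ v) i) z u]).
  rewrite -(closed_connect _ con_zv) ?inE ?connect0 //.
  apply: intro_closed => [|x y]; first exact: coloured_connect_sym.
  move=> /and4P[xA yA neq_xy cxy] con_zx; rewrite inE in con_zx; rewrite inE.
  have xAv := coloured_connect_mem con_zx zAv.
  apply: (connect_trans con_zx (connect1 _)).
  rewrite /coloured /= xAv cxy neq_xy !inE yA !andbT.
  apply: contraTneq cxy => ->; have := none x.
  by rewrite /= con_zx c_sym /= => ->.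
by move/coloured_connect_mem/(_ zAv); rewrite !inE eqxx.
Qed.

Lemma connected_colour_remove (A : {set T}) i j l v :
    i != j -> i != l -> j != l -> v \in A -> 1 < #|A| ->
    connected_colour A i -> connected_colour A j -> connected_colour A l ->
  connected_colour (A :\ v) i.
Proof.
move=> ij il jl vA A_gt1 conI conJ conL.
have [w wA neq_vw] : exists2 w, w \in A & v != w.
  have : 0 < #|A :\ v| by rewrite (cardsD1 v A) vA in A_gt1.
  by case/card_gt0P=> w /setD1P[wv wA]; exists w; rewrite // eq_sym.
have [x xAv cvx] := connected_colour_edge conJ vA wA neq_vw.
have [y yAv cvy] := connected_colour_edge conL vA wA neq_vw.
set con := connect (coloured (A :\ v) i).
(* The component of [t] has a vertex [s] with [c v s = i]; the triangle [v], [u], [s] forces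
   [c u s = b], and uniformity carries this over to [t]. *)
have spread b u t : i != b -> u \in A :\ v -> t \in A :\ v -> c v u = b ->
    ~~ con t u -> c u t = b.
  move=> ib uAv tAv cvu ncon_tu.
  have [s con_ts cvs] := component_edge conI vA tAv.
  have [] := component_uniform uAv tAv ncon_tu con_ts.
  have sAv := coloured_connect_mem con_ts tAv.
  have neq_us : u != s by apply: contraNneq ncon_tu => ->.
  have vu : v != u by case/setD1P: uAv; rewrite eq_sym.
  have vs : v != s by case/setD1P: sAv; rewrite eq_sym.
  have := c_rainbow vu neq_us vs; rewrite cvu cvs => rb cuti cus.
  move: rb; rewrite cus [b == i]eq_sym (negPf ib) (negPf cuti) !orbF.
  by move/eqP->.
have con_sym : connect_sym (coloured (A :\ v) i) by apply: coloured_connect_sym.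
(* Otherwise [spread] gives the pair [x], [y] both colours [j] and [l]. *)
have con_xy : con x y.
  case: (boolP (con x y)) => // ncon_xy; case/eqP: jl.
  rewrite -(spread l y x) //.
  by rewrite c_sym; apply/esym/spread; rewrite // /con con_sym.
(* A [z] outside the common component of [x] and [y] sees both in one colour by uniformity, but in
   [j] and [l] by [spread]. *)
have all_x z : z \in A :\ v -> con x z.
  move=> zAv; case: (boolP (con x z)) => // ncon_xz; case/eqP: jl.
  have [_] := component_uniform zAv xAv ncon_xz con_xy.
  rewrite ![c z _]c_sym (spread l y z) // ?(spread j x z) //.
    by rewrite /con con_sym.
  apply: contra ncon_xz => con_zy; apply: connect_trans con_xy _.
  by rewrite con_sym.
move=> s t sAv tAv; apply: connect_trans (all_x t tAv).
by rewrite con_sym; apply: all_x.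
Qed.

(** Descent: deleting [v] keeps all three colours connected, and two differently coloured edges at
    [v] leave at least two vertices behind. *)
Lemma gallai (A : {set T}) i j l :
    i != j -> i != l -> j != l -> 1 < #|A| ->
    connected_colour A i -> connected_colour A j -> connected_colour A l ->
  False.
Proof.
move=> ij il jl; have [n] := ubnP #|A|; elim: n A => // n IHn A le_An A_gt1.
move=> conI conJ conL.
have [v [w [vA wA neq_vw]]] := card_gt1P A_gt1.
have [x xAv cvx] := connected_colour_edge conI vA wA neq_vw.
have [y yAv cvy] := connected_colour_edge conJ vA wA neq_vw.
have neq_xy : x != y by apply: contraNneq ij => eq_xy; rewrite -cvx -cvy eq_xy.
have := cardsD1 v A; rewrite vA => cardA.
apply: (IHn (A :\ v)).
- by rewrite cardA in le_An.
- by apply/card_gt1P; exists x, y.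
- exact: (@connected_colour_remove A i j l).
- by apply: (@connected_colour_remove A j i l); rewrite // eq_sym.
- by apply: (@connected_colour_remove A l i j); rewrite // eq_sym.
Qed.

End GallaiColouring.
(** * Making a vertex a source *)

Section SourceRealizer.
Variables (T I : finType) (i0 : I) (e : rel T).
Hypothesis e_sym : symmetric e.

(* The orders g on the module H replace m in the orders h. *)
Lemma realizer_subst (m : T) (A H : {set T}) (h g : I -> T -> nat) :
    H \subset A -> m \in H ->
    {in A :\: H & H, forall x u, e x u = e x m} ->
    realizer e (m |: A :\: H) h -> {in A :\: H, forall x, ~~ before h x m} ->
    realizer e H g -> {in H, forall x, ~~ before g x m} ->
  exists k : I -> T -> nat, realizer e A k /\ {in A, forall x, ~~ before k x m}.
Proof.
move=> sHA mH modH [h_inj h_e] h_src [g_inj g_e] g_src.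
pose r x := if x \in H then m else x.
(* After collapsing [H] to [m], [h] decides every comparison except those inside [H], where [g]
   does; the value 0 never decides between distinct vertices of [A], [h] being injective. *)
pose k i := lex (fun y => h i (r y)) (fun y => if y \in H then g i y else 0).
have r_mem x : x \in A -> r x \in m |: A :\: H.
  by move=> xA; rewrite /r; case: ifP => xH; rewrite !inE ?eqxx // xH xA orbT.
have r_neq x y : x != y -> ~~ ((x \in H) && (y \in H)) -> r x != r y.
  rewrite /r; case: ifP => xH; case: ifP => yH //= _ _.
    by apply: contraFneq yH => <-.
  by apply: contraFneq xH => ->.
have kH x y : x \in H -> y \in H -> before k x y = before g x y.
  by move=> xH yH; apply: eq_forallb => i; rewrite /k lex_lt /r xH yH ltnn eqxx.
have kN x y : x \in A -> y \in A -> x != y -> ~~ ((x \in H) && (y \in H)) ->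
    before k x y = before h (r x) (r y).
  move=> xA yA neq_xy nH; apply: eq_forallb => i; rewrite /k lex_lt.
  rewrite [_ == _](_ : _ = false) ?orbF //; apply: contraNF (r_neq x y neq_xy nH).
  by move=> /eqP/(h_inj i _ _ (r_mem x xA) (r_mem y yA))/eqP.
exists k; split; last first.
  move=> x xA; case: (boolP (x \in H)) => xH; first by rewrite kH ?g_src.
  have neq_xm : x != m by apply: contraNneq xH => ->.
  rewrite kN ?(negPf xH) ?(subsetP sHA m mH) //.
  by rewrite /r mH (negPf xH) h_src // inE xH.
split=> [i x y xA yA /lex_inj[eq_r]|x y xA yA neq_xy].
  have [//|neq_xy] := eqVneq x y.
  case: (boolP ((x \in H) && (y \in H))) => [/andP[xH yH]|nH].
    by rewrite xH yH; apply: g_inj.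
  have := r_neq x y neq_xy nH.
  by rewrite (h_inj i _ _ (r_mem x xA) (r_mem y yA) eq_r) eqxx.
case: (boolP ((x \in H) && (y \in H))) => [/andP[xH yH]|nH].
  by rewrite !kH ?g_e.
rewrite !kN //; [|by rewrite eq_sym|by rewrite andbC].
rewrite -h_e ?r_mem ?r_neq //; move: nH; rewrite /r.
case: (boolP (x \in H)) => xH; case: (boolP (y \in H)) => yH // _.
  by rewrite e_sym [e m y]e_sym modH // inE yH.
by rewrite modH // inE xH.
Qed.

(** * Comparison of two transitive orientations *)

Variables (q : rel T) (f : I -> T -> nat).
Hypothesis q_e : forall x y, e x y = q x y || q y x.
Hypothesis q_asym : forall x y, ~~ (q x y && q y x).
Hypothesis q_trans : transitive q.
Hypothesis f_real : realizer e [set: T] f.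

Lemma edge_before x y : e x y = before f x y || before f y x.
Proof.
apply: (realizer_edge i0) => // z; rewrite q_e; have := q_asym z z.
by case: (q z z).
Qed.

Lemma before_trans : transitive (before f).
Proof.
move=> y x z /forallP lt_xy /forallP lt_yz.
by apply/forallP => i; apply: ltn_trans (lt_yz i).
Qed.

Definition agreement (x y : T) : option bool :=
  if e x y then Some (before f x y == q x y) else None.

Lemma before_asymb x y : ~~ (before f x y && before f y x).
Proof. by apply/andP => -[xy]; rewrite (before_asym i0 xy). Qed.

Lemma before_q x y : before f x y || before f y x = q x y || q y x.
Proof. by rewrite -edge_before q_e. Qed.

Lemma agreement_sym x y : agreement x y = agreement y x.
Proof.
rewrite /agreement !edge_before.
move: (before_asymb x y) (q_asym x y) (before_q x y).
move: (before f x y) (before f y x) (q x y) (q y x).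
by do 4!case.
Qed.

(** A rainbow triangle has exactly one non-edge. By transitivity each orientation directs the other
    two edges both towards or both away from their common vertex, so these edges have the same
    colour. *)
Lemma agreement_rainbow x y z :
  [|| agreement x y == agreement y z, agreement x y == agreement x z
    | agreement y z == agreement x z].
Proof.
have trP a b c : before f a b && before f b c ==> before f a c.
  by apply/implyP => /andP[]; apply: before_trans.
have trq a b c : q a b && q b c ==> q a c.
  by apply/implyP => /andP[]; apply: q_trans.
rewrite /agreement !edge_before.
move: (trP x y z) (trP x z y) (trP y x z) (trP y z x) (trP z x y) (trP z y x).
move: (trq x y z) (trq x z y) (trq y x z) (trq y z x) (trq z x y) (trq z y x).
move: (before_asymb x z) (q_asym x z) (before_q x z).
move: (before_asymb y z) (q_asym y z) (before_q y z).
move: (before_asymb x y) (q_asym x y) (before_q x y).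
move: (before f x y) (before f y x) (q x y) (q y x) => [] [] [] [] // _ _ _.
all: move: (before f y z) (before f z y) (q y z) (q z y) => [] [] [] [] // _ _ _.
all: by move: (before f x z) (before f z x) (q x z) (q z x) => [] [] [] [].
Qed.

Variable m : T.
Hypothesis q_src : forall x, ~~ q x m.

(** Stated for subsets so that induction on [#|A|] applies to the component of [m]. *)
Lemma source_realizer_in (A : {set T}) : m \in A ->
  exists g : I -> T -> nat, realizer e A g /\ {in A, forall x, ~~ before g x m}.
Proof.
have [n] := ubnP #|A|; elim: n A => // n IHn A le_An mA.
have [A_gt1|A_le1] := ltnP 1 #|A|; last first.
  exists f; split=> [|x xA]; first exact: realizer_sub f_real.
  by rewrite (card_le1_eqP A_le1 x m xA mA) (before_irr i0).
have [c0 ncon] : exists c0, ~ connected_colour agreement A c0.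
  apply: NNPP => none; have con c0 : connected_colour agreement A c0.
    by apply: NNPP => ncon; apply: none; exists c0.
  apply: (@gallai T _ agreement agreement_sym _ A None (Some true) (Some false)) => //.
  by move=> x y z _ _ _; apply: agreement_rainbow.
pose H := [set x | connect (coloured agreement A c0) m x].
have con_sym := coloured_connect_sym agreement_sym A c0.
have mH : m \in H by rewrite inE connect0.
have sHA : H \subset A.
  apply/subsetP => x; rewrite inE => con_mx.
  exact: (coloured_connect_mem agreement_sym con_mx mA).
have lt_HA : #|H| < #|A|.
  apply/proper_card; rewrite properE sHA; apply/subsetPn.
  apply: NNPP => none; apply: ncon => x y xA yA.
  have con z : z \in A -> connect (coloured agreement A c0) m z.
    move=> zA; case: (boolP (connect _ m z)) => // ncon_z; case: none.
    by exists z; rewrite // inE.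
  by apply: connect_trans (con y yA); rewrite con_sym con.
have [g [g_real g_src]] := IHn H (leq_trans lt_HA le_An) mH.
have uniform x u : x \in A :\: H -> u \in H ->
    agreement x m != c0 /\ agreement x u = agreement x m.
  rewrite !inE => /andP[ncon_x xA] con_u.
  apply: (component_uniform agreement_sym _ xA mA ncon_x con_u) => a b c _ _ _.
  exact: agreement_rainbow.
have modH : {in A :\: H & H, forall x u, e x u = e x m}.
  move=> x u xAH uH; have [_] := uniform x u xAH uH.
  by rewrite /agreement; case: ifP; case: ifP.
suff [h [h_real h_src]] : exists h : I -> T -> nat,
    realizer e (m |: A :\: H) h /\ {in A :\: H, forall x, ~~ before h x m}.
  exact: realizer_subst h_real h_src g_real g_src.
case: c0 @H ncon con_sym mH sHA lt_HA g_real g_src uniform modH => [b|] H _ _ mH _ _ _ _ uniform modH.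
  (* Edges from [m] to [A :\: H] do not have colour [Some b]. As [q] directs them out of [m],
     [before f] directs them into [m] if [b] is true and out of [m] otherwise. *)
  exists (if b then reverse f else f); split.
    by case: b @H {uniform modH mH} => H; [apply: realizer_reverse|]; apply: realizer_sub f_real.
  move=> x xAH; have [] := uniform x m xAH mH; rewrite /agreement.
  rewrite edge_before (negPf (q_src x)) => + _; apply: contraNN.
  case: (b); rewrite ?before_reverse => lt_xm; last by rewrite lt_xm.
  by rewrite (before_asym i0 lt_xm) lt_xm.
(* Here [m] is adjacent to all of [A :\: H], so it may come first in every order; the successor
   frees position 0 for it. *)
exists (fun i x => if x == m then 0 else (f i x).+1); split; last first.
  by move=> x _; apply/forallPn; exists i0; rewrite eqxx.
have adj x : x \in A :\: H -> e x m.
  by move=> xAH; have [] := uniform x m xAH mH; rewrite /agreement; case: ifP.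
have [f_inj _] := f_real; split=> [i x y _ _|x y].
  have [->|_] := eqVneq x m; have [->|_] := eqVneq y m => //.
  by case; apply: f_inj; rewrite inE.
have before_m z : z != m ->
    before (fun i x => if x == m then 0 else (f i x).+1) m z.
  by move=> zm; apply/forallP => i; rewrite eqxx (negPf zm).
rewrite !in_setU1 => xA yA.
have [eq_x|xm] := eqVneq x m.
  rewrite eq_x eq_sym => ym; rewrite before_m // e_sym adj //.
  by rewrite (negPf ym) in yA.
have [-> _|ym neq_xy] := eqVneq y m.
  by rewrite before_m // orbT adj //; rewrite (negPf xm) in xA.
rewrite edge_before; congr (_ || _); apply: eq_forallb => i;
  by rewrite (negPf xm) (negPf ym).
Qed.

Lemma source_realizer :
  exists g : I -> T -> nat, realizer e [set: T] g /\ forall x, ~~ before g x m.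
Proof.
have [g [g_real g_src]] := source_realizer_in (in_setT m).
by exists g; split=> // x; apply: g_src; rewrite inE.
Qed.

End SourceRealizer.
(** * Split recomposition *)

Lemma edge_neq (G : sgraph) (x y : G) : edge x y -> y != x.
Proof. by apply: contraTneq => ->; rewrite edge_irrefl. Qed.

Lemma connected_edge (G : sgraph) (x y : G) :
  connected G -> y != x -> exists z, edge x z.
Proof.
move=> conG neq_yx; have /connectP[[|z p] /=] := conG x y.
  by move=> _ eq_yx; rewrite eq_yx eqxx in neq_yx.
by case/andP=> xz _ _; exists z.
Qed.

Section SplitBounds.
Variables (G G' : sgraph) (m : G) (m' : G').
Local Notation GG := (split_recomposition m m').

Lemma split_embed_left (b : G') : edge m' b ->
  exists h : G -> GG, injective h /\ forall x y, edge x y = edge (h x) (h y).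
Proof.
move=> m'b; have neq_b := edge_neq m'b.
(* [insub] fails only at [m], which is sent to the neighbour [b] of [m']. *)
pose h (x : G) : GG := match insub x with
  Some u => inl u | None => inr (exist (fun x => x != m') b neq_b) end.
exists h; split=> x y; rewrite /h.
  case: insubP => [u _ ux|]; case: insubP => [v _ vy|] //.
    by case=> uv; rewrite -ux -vy uv.
  by rewrite !negbK => /eqP-> /eqP->.
case: insubP => [u _ ux|/negbNE/eqP->]; case: insubP => [v _ vy|/negbNE/eqP->] /=.
- by rewrite ux vy.
- by rewrite ux m'b andbT edge_sym.
- by rewrite vy m'b andbT.
by rewrite !edge_irrefl.
Qed.

Lemma split_embed_right (a : G) : edge m a ->
  exists h : G' -> GG, injective h /\ forall x y, edge x y = edge (h x) (h y).
Proof.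
move=> ma; have neq_a := edge_neq ma.
pose h (x : G') : GG := match insub x with
  Some u => inr u | None => inl (exist (fun x => x != m) a neq_a) end.
exists h; split=> x y; rewrite /h.
  case: insubP => [u _ ux|]; case: insubP => [v _ vy|] //.
    by case=> uv; rewrite -ux -vy uv.
  by rewrite !negbK => /eqP-> /eqP->.
case: insubP => [u _ ux|/negbNE/eqP->]; case: insubP => [v _ vy|/negbNE/eqP->] /=.
- by rewrite ux vy.
- by rewrite ux ma /= edge_sym.
- by rewrite vy ma.
by rewrite !edge_irrefl.
Qed.

Variables (I : finType) (i0 : I) (f : I -> G -> nat) (f' : I -> G' -> nat).
Hypothesis f_real : realizer (@edge G) [set: G] f.
Hypothesis f'_real : realizer (@edge G') [set: G'] f'.
Hypothesis m_source : forall x, ~~ before f x m.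
Hypothesis m'_sink : forall y, ~~ before f' m' y.

(* If the i-th orders are Z m W and X m' Y, then the order [Some i] is
   Z X W Y; the order [None] puts all of V' before V. *)
Definition split_block (o : option I) (u : recomp_vertex m m') : nat :=
  match o, u with
  | None, inl _ => 1
  | None, inr _ => 0
  | Some i, inl a => if f i (val a) < f i m then 0 else 2
  | Some i, inr b => if f' i (val b) < f' i m' then 1 else 3
  end.

(** Inside [V] and inside [V'] the extra order [None] copies the order [i0], so it removes no
    comparability there. *)
Definition split_inner (o : option I) (u : recomp_vertex m m') : nat :=
  match u with
  | inl a => f (odflt i0 o) (val a)
  | inr b => f' (odflt i0 o) (val b)
  end.

Definition split_order (o : option I) : recomp_vertex m m' -> nat :=
  lex (split_block o) (split_inner o).

(** The block number of a vertex of [V] is monotone in its position under [f i], so cutting at [m]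
    does not disturb the order on [V]. *)
Lemma split_order_left o a b :
  (split_order o (inl a) < split_order o (inl b))
    = (f (odflt i0 o) (val a) < f (odflt i0 o) (val b)).
Proof.
rewrite /split_order lex_lt; case: o => //= i.
case: (ltnP _ (f i m)) => ma; case: (ltnP _ (f i m)) => mb //=; apply/esym.
  exact: leq_trans mb.
by apply/negbTE; rewrite -leqNgt ltnW // (leq_trans mb).
Qed.

Lemma split_order_right o a b :
  (split_order o (inr a) < split_order o (inr b))
    = (f' (odflt i0 o) (val a) < f' (odflt i0 o) (val b)).
Proof.
rewrite /split_order lex_lt; case: o => //= i.
case: (ltnP _ (f' i m')) => ma; case: (ltnP _ (f' i m')) => mb //=; apply/esym.
  exact: leq_trans mb.
by apply/negbTE; rewrite -leqNgt ltnW // (leq_trans mb).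
Qed.

Lemma before_split_left a b :
  before split_order (inl a) (inl b) = before f (val a) (val b).
Proof.
apply/forallP/forallP => [lt_ab i|lt_ab o]; last by rewrite split_order_left.
by have := lt_ab (Some i); rewrite split_order_left.
Qed.

Lemma before_split_right a b :
  before split_order (inr a) (inr b) = before f' (val a) (val b).
Proof.
apply/forallP/forallP => [lt_ab i|lt_ab o]; last by rewrite split_order_right.
by have := lt_ab (Some i); rewrite split_order_right.
Qed.

Lemma before_split_cross a b : before split_order (inl a) (inr b) = false.
Proof. by apply/negbTE/forallPn; exists None; rewrite /split_order lex_lt. Qed.

(** In [Z X W Y] a vertex of [V'] precedes one of [V] only if they lie in [X] and [W]. Holding for
    all [i], this means comparability with [m'] and [m], since these are a sink and a source. *)
Lemma before_split_marker a b : before split_order (inr b) (inl a)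
  = edge m (val a) && edge m' (val b).
Proof.
have [[f_inj _] [f'_inj _]] := (f_real, f'_real).
rewrite (realizer_edge i0 (@edge_irrefl G) f_real) (negPf (m_source _)) orbF.
rewrite (realizer_edge i0 (@edge_irrefl G') f'_real) (negPf (m'_sink _)) /=.
apply/forallP/andP => [lt_ba|[/forallP lt_ma /forallP lt_bm] [i|]].
- have lt_i i : f i m < f i (val a) /\ f' i (val b) < f' i m'.
    have := lt_ba (Some i); rewrite /split_order lex_lt /=.
    case: (ltngtP (f i (val a)) (f i m)) => [||/f_inj].
    + by case: ifP.
    + by case: ifP.
    by rewrite !inE => /(_ isT isT) eq_am; have := valP a; rewrite /= eq_am eqxx.
  by split; apply/forallP => i; case: (lt_i i).
- rewrite /split_order lex_lt /= lt_bm ltnNge; have := ltnW (lt_ma i).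
  by case: leqP.
by rewrite /split_order lex_lt.
Qed.

Lemma split_order_realizer :
  realizer (@recomp_edge G G' m m') [set: recomp_vertex m m'] split_order.
Proof.
have [[f_inj _] [f'_inj _]] := (f_real, f'_real).
split=> [o|] [a|b] [c|d] _ _.
- by case/lex_inj=> _ /f_inj; rewrite !inE => /(_ isT isT)/val_inj->.
(* Blocks of [V] and [V'] never coincide: even against odd for [Some i], 1 against 0 for [None]. *)
- by case/lex_inj; case: o => //= i; do 2!case: ifP.
- by case/lex_inj; case: o => //= i; do 2!case: ifP.
- by case/lex_inj=> _ /f'_inj; rewrite !inE => /(_ isT isT)/val_inj->.
- rewrite !before_split_left => _.
  exact: (realizer_edge i0 (@edge_irrefl G) f_real).
- by rewrite before_split_cross before_split_marker.
- by rewrite before_split_cross before_split_marker orbF.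
rewrite !before_split_right => _.
exact: (realizer_edge i0 (@edge_irrefl G') f'_real).
Qed.

End SplitBounds.

Lemma perm_representable_induced (G H : sgraph) (h : G -> H) (x : G) k :
  injective h -> (forall x y, edge x y = edge (h x) (h y)) ->
  perm_representable H k -> perm_representable G k.
Proof.
move=> h_inj h_e repH; have k_gt0 := perm_representable_gt0 (h x) repH.
have [f /(realizer_pullback h_inj h_e) f_real] := perm_representable_realizer repH.
have := realizer_perm_representable (Ordinal k_gt0) f_real.
by rewrite card_ord.
Qed.

Lemma perm_representable_source (G : sgraph) (r : rel G) (m : G) k K :
  transitive_orientation r -> source r m ->
  perm_representable G k -> k <= K ->
  exists f : 'I_K -> G -> nat,
    realizer (@edge G) [set: G] f /\ forall x, ~~ before f x m.
Proof.
move=> [[r_e r_asym] r_trans] r_src rep le_kK.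
have k_gt0 := perm_representable_gt0 m rep.
have [f0 /(realizer_widen k_gt0 le_kK)[f f_real]] := perm_representable_realizer rep.
have K_gt0 := leq_trans k_gt0 le_kK.
apply: (source_realizer (Ordinal K_gt0) (@edge_sym G) r_e r_asym r_trans f_real).
by move=> x; have /cards0_eq/setP/(_ x) := r_src; rewrite !inE => ->.
Qed.

(** Dual to the source case: reverse the orientation, then reverse the orders obtained. *)
Lemma perm_representable_sink (G : sgraph) (r : rel G) (m : G) k K :
  transitive_orientation r -> sink r m ->
  perm_representable G k -> k <= K ->
  exists f : 'I_K -> G -> nat,
    realizer (@edge G) [set: G] f /\ forall x, ~~ before f m x.
Proof.
move=> [[r_e r_asym] r_trans] r_sink rep le_kK.
have r'_or : transitive_orientation (fun x y => r y x).
  split; first by split=> x y; [rewrite r_e orbC|apply: r_asym].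
  by move=> y x z ryx rzy; apply: r_trans rzy ryx.
have [f [f_real f_src]] := perm_representable_source r'_or r_sink rep le_kK.
exists (reverse f); split=> [|x]; first exact: realizer_reverse.
by rewrite before_reverse.
Qed.

Theorem theorem6 (G G' : sgraph) (m : G) (m' : G') (k k' : nat)
    (hG : connected G) (hG' : connected G')
    (hV : exists v : G, v != m) (hV' : exists v' : G', v' != m')
    (cG : comparability_graph G) (cG' : comparability_graph G')
    (hm : exists r : rel G, transitive_orientation r /\ source r m)
    (hm' : exists r' : rel G', transitive_orientation r' /\ sink r' m')
    (hk : is_Rp G k) (hk' : is_Rp G' k') :
  is_Rp (split_recomposition m m') (maxn k k')
  \/ is_Rp (split_recomposition m m') (1 + maxn k k').
Proof.
have [[rep k_min] [rep' k'_min]] := (hk, hk').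
have [[v neq_v] [v' neq_v']] := (hV, hV').
have [a ma] := connected_edge hG neq_v; have [b m'b] := connected_edge hG' neq_v'.
have lower j : perm_representable (split_recomposition m m') j -> maxn k k' <= j.
  move=> repGG; rewrite geq_max; apply/andP; split.
    have [h [h_inj h_e]] := split_embed_left m m'b.
    exact/k_min/(perm_representable_induced m h_inj h_e).
  have [h [h_inj h_e]] := split_embed_right m' ma.
  exact/k'_min/(perm_representable_induced m' h_inj h_e).
have upper : perm_representable (split_recomposition m m') (1 + maxn k k').
  have [[r [r_or r_src]] [r' [r'_or r'_sink]]] := (hm, hm').
  have [f [f_real f_src]] :=
    perm_representable_source r_or r_src rep (leq_maxl k k').
  have [f' [f'_real f'_sink]] :=
    perm_representable_sink r'_or r'_sink rep' (leq_maxr k k').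
  have max_gt0 : 0 < maxn k k'.
    exact: leq_trans (perm_representable_gt0 m rep) (leq_maxl k k').
  (* The orders are indexed by [option 'I_(maxn k k')], whence the additional 1. *)
  have := @realizer_perm_representable (split_recomposition m m') _ None _
    (split_order_realizer (Ordinal max_gt0) f_real f'_real f_src f'_sink).
  by rewrite card_option card_ord.
have [rep_max|nrep_max] := classic
    (perm_representable (split_recomposition m m') (maxn k k')); [left|right].
  by split.
split=> // j repj; rewrite add1n ltn_neqAle lower // andbT.
by apply/eqP => eq_j; apply: nrep_max; rewrite eq_j.
Qed.
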